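(* For every integer $k\ge1$ there exists a $k$-crossing family $\mathcal F$ of demand functions such that every markdown policy $X$ satisfies $$\mathrm{Reg}(X,\mathcal F)=\Omega\big(n^{\frac{k}{k+1}}\big),$$ i.e. there are constants $c>0$ and $n_0$ such that for every $n\ge n_0$ and every markdown policy $X$ for horizon $n$, $\mathrm{Reg}(X,\mathcal F)\ge c\,n^{k/(k+1)}$.
   Context: **Model.** Prices lie in $[0,1]$; the horizon is $n$ rounds. A demand function is a map $d:[0,1]\to[0,1]$, with revenue function $r(x)=x\,d(x)$. In round $t$ the seller chooses $X_t\in[0,1]$, measurable with respect to $\sigma(X_1,D_1,\dots,X_{t-1},D_{t-1})$ (a policy; it may depend on $n$ and on $\mathcal F$), and observes a random demand $D_t$ which, given $X_t=x$, is Bernoulli with mean $d(x)$, independent of the past. A policy is a markdown policy if $X_{t-1}\ge X_t$ almost surely for $t=2,\dots,n$. The regret is $\mathrm{Reg}(X,d)=n\max_{p\in[0,1]}p\,d(p)-\mathbb E[\sum_{t=1}^nX_td(X_t)]$ when the true demand function is $d$, and $\mathrm{Reg}(X,\mathcal F)=\sup_{d\in\mathcal F}\mathrm{Reg}(X,d)$. **Standing assumptions on families.** Each revenue function $r$ of a member of $\mathcal F$ is differentiable, has a unique maximizer $p^*$ on $[0,1]$, and $r'(p^* )=0$. **Crossing number.** For $\mathbf p=(p_0,\dots,p_k)\in[0,1]^{k+1}$ the profile mapping is $\Phi_{\mathbf p}:\mathcal F\to\mathbb R^{k+1}$, $d\mapsto(d(p_0),\dots,d(p_k))$, with range $\mathcal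 R_{\mathbf p}$; the dispersion is $h(\mathbf p)=\min_{i\ne j}|p_i-p_j|$. $\mathcal F$ is $k$-identifiable if $\Phi_{\mathbf p}$ is injective for all $\mathbf p\in[0,1]^{k+1}$ with distinct entries. A robust order-$k$ parametrization is a bijection $\theta\mapsto d(\cdot;\theta)$ from a set $\Theta\subseteq\mathbb R^{k+1}$ onto $\mathcal F$ such that $\Theta$ is compact; $d:[0,1]\times\Theta\to\mathbb R$ is twice continuously differentiable; the map $p^*:\Theta\to[0,1]$ sending $\theta$ to the maximizer of $x\,d(x;\theta)$ is Lipschitz; and there are constants $c_1,c_2>0$ such that for all $\mathbf p\in[0,1]^{k+1}$ with $0<h(\mathbf p)\le c_1$ and all $\mathbf y,\mathbf y'\in\mathcal R_{\mathbf p}$ with $\|\mathbf y-\mathbf y'\|_1\le c_1$, $$\|\Phi_{\mathbf p}^{-1}(\mathbf y)-\Phi_{\mathbf p}^{-1}(\mathbf y')\|_1\le c_2\,\|\mathbf y-\mathbf y'\|_1\,h(\mathbf p)^{-k}$$ (identifying $\mathcal F$ with $\Theta$; for $k=0$ this condition just means that $\Phi_{\mathbf p}^{-1}$ is $c_2$-Lipschitz). The crossing number of $\mathcal F$ is the least integer $k\ge0$ such that $\mathcal F$ is $k$-identifiable and admits a robust order-$k$ parametrization; $\mathcal F$ is $k$-crossing if its crossing number is $k$. *)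

(* Defs.v *)
From HB Require Import structures.
From mathcomp Require Export all_boot all_order all_algebra.
From mathcomp Require Export all_classical all_reals all_analysis.
Export Order.TTheory GRing.Theory Num.Theory.
Export numFieldNormedType.Exports.

Set Implicit Arguments.
Unset Strict Implicit.
Unset Printing Implicit Defensive.

Local Open Scope classical_set_scope.
Local Open Scope ring_scope.

Section Demand.
Variable R : realType.

(* A map [0,1] -> [0,1] is encoded by its extension by 0 to R, so that Leibniz
   equality of encodings is equality of maps on [0,1]. *)
Definition demand_function (d : R -> R) : Prop :=
  (forall x, 0 <= x <= 1 -> 0 <= d x <= 1) /\
  (forall x, ~~ (0 <= x <= 1) -> d x = 0).

Definition revenue (d : R -> R) (x : R) : R := x * d x.

(* f'(x) = l for f restricted to [0,1] (one-sided at the endpoints) *)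
Definition has_derivative01 (f : R -> R) (x l : R) : Prop :=
  (fun y => (f y - f x) / (y - x)) @ within `[0, 1] x^' --> l.

Definition is_maximizer (f : R -> R) (p : R) : Prop :=
  0 <= p <= 1 /\ forall x, 0 <= x <= 1 -> f x <= f p.

Definition demand_family (F : set (R -> R)) : Prop :=
  forall d, F d ->
  [/\ demand_function d,
      (forall x, 0 <= x <= 1 -> exists l, has_derivative01 (revenue d) x l) &
      exists p, [/\ is_maximizer (revenue d) p,
                    (forall q, is_maximizer (revenue d) q -> q = p) &
                    has_derivative01 (revenue d) p 0]].

End Demand.

Section Crossing.
Variable R : realType.

Definition l1norm (m : nat) (v : 'rV[R]_m) : R := \sum_(i < m) `|v 0 i|.

Definition in_cube (m : nat) (p : 'rV[R]_m) : Prop :=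
  forall i, 0 <= p 0 i <= 1.

Definition profile (m : nat) (p : 'rV[R]_m) (d : R -> R) : 'rV[R]_m :=
  \row_i d (p 0 i).

(* The default value 1 is harmless when there are at least two entries, all of
   them in [0,1]; with a single entry the dispersion is never used below. *)
Definition dispersion (m : nat) (p : 'rV[R]_m) : R :=
  \big[Num.min/1]_(ij : 'I_m * 'I_m | ij.1 != ij.2)
    `|p 0 ij.1 - p 0 ij.2|.

Definition identifiable (k : nat) (F : set (R -> R)) : Prop :=
  forall p : 'rV[R]_k.+1, in_cube p -> injective (p 0) ->
  set_inj F (profile p).

(* On an open set U: all iterated directional derivatives of order at most m
   exist, and those of order m are continuous. *)
Fixpoint continuously_differentiable (V : normedModType R) (m : nat)
    (U : set V) (g : V -> R^o) : Prop :=
  match m with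
  | 0 => forall z, U z -> {for z, continuous g}
  | m'.+1 => forall v : V, (forall z, U z -> derivable g z v) /\
                           continuously_differentiable m' U ('D_v g)
  end.

(* C^2 on the compact set [0,1] x Theta, which need not be the closure of an
   open set: restriction of a C^2 function defined on an open neighbourhood. *)
Definition C2_on (k : nat) (Theta : set 'rV[R]_k.+1)
    (d : 'rV[R]_k.+1 -> R -> R) : Prop :=
  exists (U : set (R^o * 'rV[R]_k.+1)%type)
         (g : (R^o * 'rV[R]_k.+1)%type -> R^o),
  [/\ open U, `[0, 1] `*` Theta `<=` U,
      continuously_differentiable 2 U g &
      forall x theta, 0 <= x <= 1 -> Theta theta ->
        g (x, theta) = d theta x].

(* In the stability estimate y and y' are Phi_p (d theta) and Phi_p (d theta'),
   so theta and theta' are their preimages under Phi_p; for k = 0 there is no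
   condition on p, y, y', and h(p)^0 = 1. *)
Definition robust_parametrization (k : nat) (F : set (R -> R))
    (Theta : set 'rV[R]_k.+1) (d : 'rV[R]_k.+1 -> R -> R) : Prop :=
  [/\ set_bij Theta F d,
      compact Theta,
      C2_on Theta d,
      (exists pstar : 'rV[R]_k.+1 -> R^o,
         (forall theta, Theta theta ->
            is_maximizer (revenue (d theta)) (pstar theta)) /\
         [lipschitz pstar theta | theta in Theta]) &
      exists c1 c2 : R, [/\ 0 < c1, 0 < c2 &
        forall (p : 'rV[R]_k.+1) (theta theta' : 'rV[R]_k.+1),
          in_cube p -> Theta theta -> Theta theta' ->
          let y := profile p (d theta) in
          let y' := profile p (d theta') in
          ((0 < k)%N -> 0 < dispersion p <= c1 /\ l1norm (y - y') <= c1) ->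
          l1norm (theta - theta') <= c2 * l1norm (y - y') / dispersion p ^+ k]].

Definition robustly_identifiable (k : nat) (F : set (R -> R)) : Prop :=
  identifiable k F /\
  exists (Theta : set 'rV[R]_k.+1) (d : 'rV[R]_k.+1 -> R -> R),
    robust_parametrization F Theta d.

Definition k_crossing (k : nat) (F : set (R -> R)) : Prop :=
  robustly_identifiable k F /\
  forall j : nat, robustly_identifiable j F -> (k <= j)%N.

End Crossing.

Section Policies.
Variables (R : realType) (disp : measure_display) (Omega : measurableType disp).
Variable n : nat.
Variables (X : 'I_n -> Omega -> R) (D : 'I_n -> Omega -> bool).

(* sigma(X_s, D_s : s < t) *)
Definition history (t : 'I_n) : set (set Omega) :=
  <<s \bigcup_(s in [set s : 'I_n | (s < t)%N])
        (preimage_set_system setT (X s) measurable `|`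
         preimage_set_system setT (D s) measurable) >>.

Definition is_policy : Prop :=
  (forall t w, 0 <= X t w <= 1) /\
  (forall t (B : set R), measurable B -> history t (X t @^-1` B)).

(* Under P, the conditional law of D_t given the history is Bernoulli with
   mean d(X_t); X_t itself is measurable with respect to the history. *)
Definition demand_model (P : probability Omega R) (d : R -> R) : Prop :=
  (forall t, measurable_fun setT (D t)) /\
  (forall t (A : set Omega), history t A ->
     P (A `&` D t @^-1` [set true]) = (\int[P]_(w in A) (d (X t w))%:E)%E).

Definition markdown (P : probability Omega R) : Prop :=
  forall s t : 'I_n, t = s.+1 :> nat -> {ae P, forall w, X t w <= X s w}.

Definition regret (P : probability Omega R) (d : R -> R) : \bar R :=
  ((n%:R * sup [set revenue d p | p in `[0, 1]])%:E
   - 'E_P[fun w => (\sum_(t < n) revenue d (X t w))%R])%E.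

(* P d is the law of the model when the true demand function is d *)
Definition family_regret (P : (R -> R) -> probability Omega R)
    (F : set (R -> R)) : \bar R :=
  ereal_sup [set regret (P d) d | d in F].

End Policies.

(* Main.v *)
Require Import Defs.
From mathcomp Require Import measurable_realfun ring lra.
Local Open Scope classical_set_scope.
Local Open Scope ring_scope.

(** Two demand functions already force the rate.  Write [u = 1 - x] and take
    [d0 = s (1 + u)] and [d1 = d0 + b u^k].  The revenue [s (1 - u^2)] of [d0]
    is maximal at price 1, that of [d1] at a price bounded away from 1.  The
    difference [b u^k] has a root of order [k] at price 1, which makes the pair
    [k]-crossing: values at prices [1 - i e] only separate [d0] from [d1] at
    scale [e^k].

    Let [h = n^(-1/(2(k+1)))] and [m ~ n^(k/(k+1)) = n h^2].  While prices stay
    above [1 - h], each observation has chi-square divergence at most of order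
    [h^(2k) ~ 1/m], so during the first [m] rounds the two models cannot be told
    apart.  Under [d0], leaving [[1 - h, 1]] before round [m] costs a constant
    times [h^2] in each of the at least [n/2] remaining rounds, because prices
    cannot go up again; under [d1], staying there costs a constant in each of
    the first [m] rounds.  Either way the regret is of order [n^(k/(k+1))]. *)

Set Implicit Arguments.
Unset Strict Implicit.
Unset Printing Implicit Defensive.

(** * The two demand functions *)

Section HardPair.
Variable R : realType.

Definition gap_poly (k : nat) (y : R) : R :=
  3 + y ^+ 2 - (4 * k%:R + 2) * y ^+ k + (4 * k%:R - 2) * y ^+ k.+1.

(** Induction on [k], starting from [3 (y - 1)^2]. Passing from [k] to [k + 1] multiplies by [y] and
    adds [(1 - y) (3 + y^2 - 4 y^(k+1))], whose two factors change sign together at 1. *)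
Lemma gap_poly_gt0 (k : nat) (y : R) :
  (0 < k)%N -> 0 <= y -> y != 1 -> 0 < gap_poly k y.
Proof.
case: k => // k _ y0 y1; rewrite /gap_poly; elim: k => [|k IHk].
  have -> : 3 + y ^+ 2 - (4 * 1%:R + 2) * y ^+ 1 + (4 * 1%:R - 2) * y ^+ 2
     = 3 * (y - 1) ^+ 2 :> R by ring.
  by rewrite mulr_gt0// exprn_even_gt0//= subr_eq0.
set z := y ^+ k.+1 in IHk *.
(* On either side of 1, [y z] is compared with [y^2], and [3 + y^2 - 4 y^2 = 3 (1 - y^2)]. *)
have step : 0 < (1 - y) * (3 + y ^+ 2 - 4 * (y * z)).
  have [yl|yg|/eqP] := ltgtP y 1; last by rewrite (negbTE y1).
    have zy : z <= y by rewrite /z exprS ler_piMr// exprn_ile1// ltW.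
    apply: mulr_gt0; first by rewrite subr_gt0.
    have : y * z <= y * y by rewrite ler_wpM2l.
    nra.
  have zy : y <= z by rewrite /z exprS ler_peMr// exprn_ege1// ltW.
  rewrite -mulrNN; apply: mulr_gt0; first by rewrite oppr_gt0 subr_lt0.
  have : y * y <= y * z by rewrite ler_wpM2l.
  nra.
suff -> : 3 + y ^+ 2 - (4 * k.+2%:R + 2) * y ^+ k.+2
      + (4 * k.+2%:R - 2) * y ^+ k.+3 =
    y * (3 + y ^+ 2 - (4 * k.+1%:R + 2) * z + (4 * k.+1%:R - 2) * y ^+ k.+2)
    + (1 - y) * (3 + y ^+ 2 - 4 * (y * z)).
  by rewrite ltr_wpDl// mulr_ge0// ltW.
rewrite (exprS y k.+2) (exprS y k.+1) -/z -(natr1 k.+1); ring.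
Qed.

Variable k : nat.
Hypothesis k_gt0 : (0 < k)%N.

(* Chosen so that the revenue of the second demand function is maximal exactly
   at price [1 - discount]: its shortfall at price [x] is then a multiple of
   [gap_poly] at [(1 - x) / discount], which has a double root at 1. *)
Definition discount : R := (2 * k%:R - 1) / (2 * k%:R + 1).
Definition ratio : R := (4 * k%:R + 2) * discount ^+ 2 / discount ^+ k.
(** Normalised so that [4 scale + bump = 1]: demands then stay at least [scale] away from 0 and 1,
    which later bounds the divergences. *)
Definition scale : R := (4 + ratio)^-1.
Definition bump : R := ratio * scale.

Lemma k_ge1 : 1 <= k%:R :> R. Proof. by rewrite ler1n. Qed.

Lemma discount_gt0 : 0 < discount.
Proof. by have := k_ge1 => ?; rewrite /discount divr_gt0//; lra. Qed.

Lemma discount_lt1 : discount < 1.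
Proof. by have := k_ge1 => ?; rewrite /discount ltr_pdivrMr; lra. Qed.

Lemma ratio_gt0 : 0 < ratio.
Proof.
have := k_ge1 => ?.
by rewrite /ratio !(divr_gt0, mulr_gt0, exprn_gt0) ?discount_gt0//; lra.
Qed.

Lemma scale_gt0 : 0 < scale.
Proof. by rewrite /scale invr_gt0; have := ratio_gt0; lra. Qed.

Lemma bump_gt0 : 0 < bump.
Proof. by rewrite mulr_gt0// ?ratio_gt0 ?scale_gt0. Qed.

Lemma scale_bump : 4 * scale + bump = 1.
Proof.
by rewrite /bump -mulrDl /scale mulfV//; have := ratio_gt0; lra.
Qed.

(** The pair consists of [c = 0] and [c = 1]; dependence on [c] is affine, which makes the
    parametrization smooth. *)
Definition demand_poly (c : R) : {poly R} :=
  scale *: (2%:P - 'X) + (c * bump) *: (1 - 'X) ^+ k.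

Lemma demand_polyE c x :
  (demand_poly c).[x] = scale * (2 - x) + c * bump * (1 - x) ^+ k.
Proof. by rewrite /demand_poly; move: scale bump => s b; rewrite !hornerE. Qed.

Lemma deriv_revenue_poly c x : (deriv ('X * demand_poly c)).[x] =
  scale * (2 - 2 * x) + c * bump * ((1 - x) ^+ k - k%:R * x * (1 - x) ^+ k.-1).
Proof.
rewrite /demand_poly; move: scale bump => s b.
rewrite derivM derivX derivD !derivZ derivB derivC derivX deriv_exp derivB.
rewrite derivX derivC !hornerE hornerMn !hornerE -mulr_natr; ring.
Qed.

Lemma bump_discount :
  bump * discount ^+ k = (4 * k%:R + 2) * scale * discount ^+ 2.
Proof.
rewrite /bump /ratio; have := expf_neq0 k (lt0r_neq0 discount_gt0).
move: (discount ^+ k) => z z0; by field.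
Qed.

Lemma revenue_gap0 x : scale - x * (demand_poly 0).[x] = scale * (1 - x) ^+ 2.
Proof. by rewrite demand_polyE; ring. Qed.

Definition max_revenue1 : R := (1 - discount) * (demand_poly 1).[1 - discount].

Lemma revenue_gap1 x :
  max_revenue1 - x * (demand_poly 1).[x] =
  scale * discount ^+ 2 * gap_poly k ((1 - x) / discount).
Proof.
have u0 := lt0r_neq0 discount_gt0.
rewrite /max_revenue1 /gap_poly !demand_polyE.
have -> : 1 - (1 - discount) = discount by ring.
have E := bump_discount.
have -> : (1 - x) ^+ k = discount ^+ k * ((1 - x) / discount) ^+ k.
  by rewrite -exprMn mulrCA mulfV// mulr1.
rewrite !exprS !expr0 !mulr1.
set y := (1 - x) / discount.
have xE : x = 1 - discount * y by rewrite /y mulrCA mulfV// mulr1; ring.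
have uE : (2 * k%:R + 1) * discount - (2 * k%:R - 1) = 0 :> R.
  by rewrite /discount mulrCA mulfV ?mulr1 ?subrr//; have := k_ge1 => ?; lra.
rewrite xE; apply/eqP; rewrite -subr_eq0; apply/eqP.
rewrite (_ : 1 * bump * discount ^+ k =
   (4 * k%:R + 2) * scale * (discount * discount)); last first.
  by rewrite mul1r E expr2.
rewrite (_ : 1 * bump * (discount ^+ k * y ^+ k) =
   (4 * k%:R + 2) * scale * (discount * discount) * y ^+ k); last first.
  by rewrite mul1r mulrA E expr2.
(* The two sides differ by this multiple of [(2k + 1) discount - (2k - 1)], which is zero by the
   choice of [discount]. *)
rewrite -[RHS](mulr0 (2 * scale * (discount * discount) * (y * y ^+ k - 1))).
by rewrite -uE; ring.
Qed.

Lemma revenue_lt1 (x : R) :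
  0 <= x <= 1 -> x != 1 - discount -> x * (demand_poly 1).[x] < max_revenue1.
Proof.
move=> /andP[x0 x1] xu; rewrite -subr_gt0 revenue_gap1.
apply: mulr_gt0; first by rewrite mulr_gt0 ?scale_gt0 ?exprn_gt0 ?discount_gt0.
apply: gap_poly_gt0 => //.
  by rewrite divr_ge0 ?subr_ge0// ltW// discount_gt0.
apply: contra_neq xu => E.
have := divfK (lt0r_neq0 discount_gt0) (1 - x); rewrite E mul1r => ->; ring.
Qed.

Lemma deriv_revenue0 : (deriv ('X * demand_poly 0)).[1] = 0.
Proof. by rewrite deriv_revenue_poly; ring. Qed.

Lemma deriv_revenue1 : (deriv ('X * demand_poly 1)).[1 - discount] = 0.
Proof.
rewrite deriv_revenue_poly; have u0 := lt0r_neq0 discount_gt0.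
rewrite (_ : 1 - (1 - discount) = discount); last by ring.
(* Multiplying by [discount] clears the denominator of [discount^(k-1) = discount^k / discount], so
   that [bump_discount] applies. *)
apply: (mulfI u0).
have -> : discount ^+ k.-1 = discount ^+ k / discount.
  by rewrite -[in RHS](prednK k_gt0) exprS mulrC mulKf.
rewrite mulr0 !mul1r.
have -> : discount * (scale * (2 - 2 * (1 - discount)) +
    bump * (discount ^+ k -
            k%:R * (1 - discount) * (discount ^+ k / discount))) =
  2 * scale * discount ^+ 2 +
  bump * discount ^+ k * (discount - k%:R * (1 - discount)).
  by field.
rewrite bump_discount.
have uE : (2 * k%:R + 1) * discount - (2 * k%:R - 1) = 0 :> R.
  by rewrite /discount mulrCA mulfV ?mulr1 ?subrr//; have := k_ge1 => ?; lra.
by rewrite -[RHS](mulr0 (2 * scale * discount ^+ 2 * (k%:R + 1))) -uE; ring.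
Qed.

Lemma demand_poly_bounds c x : 0 <= c <= 1 -> 0 <= x <= 1 ->
  scale <= (demand_poly c).[x] <= 1 - 2 * scale.
Proof.
move=> /andP[c0 c1] /andP[x0 x1]; rewrite demand_polyE.
have := scale_gt0; have := bump_gt0; have := scale_bump => E b0 s0.
have z0 : 0 <= (1 - x) ^+ k by rewrite exprn_ge0// subr_ge0.
have z1 : (1 - x) ^+ k <= 1 by rewrite exprn_ile1 ?subr_ge0//; lra.
have cb : c * bump <= bump by rewrite ler_piMl// ltW.
have cb0 : 0 <= c * bump by rewrite mulr_ge0// ltW.
have : c * bump * (1 - x) ^+ k <= bump by apply: le_trans cb; rewrite ler_piMr.
have : 0 <= c * bump * (1 - x) ^+ k by rewrite mulr_ge0.
by move=> *; apply/andP; split; nra.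
Qed.

(** For [y = (1 - x) / discount] the condition on [h] gives [(4k + 2) y <= 2]. Hence [y <= 1], so
    [(4k + 2) y^k <= 2] as well, and [gap_poly] is at least [3 - 2]. *)
Lemma revenue_gap1_near (x h : R) : 0 <= x <= 1 -> 1 - x <= h ->
  h * (4 * k%:R + 2) <= 2 * discount ->
  scale * discount ^+ 2 <= max_revenue1 - x * (demand_poly 1).[x].
Proof.
move=> /andP[x0 x1] xh hu; rewrite revenue_gap1.
rewrite ler_peMr//.
  by rewrite mulr_ge0 ?ltW ?scale_gt0 ?exprn_gt0 ?discount_gt0.
set y := (1 - x) / discount.
have u0 := discount_gt0.
have y0 : 0 <= y by rewrite /y divr_ge0 ?subr_ge0// ltW.
have yk : (4 * k%:R + 2) * y <= 2.
  rewrite /y mulrA ler_pdivrMr//; apply: le_trans hu.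
  by rewrite [leRHS]mulrC ler_wpM2l.
have y1 : y <= 1.
  have := k_ge1 => ?.
  have : 6 * y <= (4 * k%:R + 2) * y by rewrite ler_wpM2r//; lra.
  lra.
have : (4 * k%:R + 2) * y ^+ k <= 2.
  apply: le_trans yk; rewrite ler_wpM2l ?addr_ge0 ?mulr_ge0//.
  by rewrite -(prednK k_gt0) exprS ler_piMr// exprn_ile1.
have : 0 <= (4 * k%:R - 2) * y ^+ k.+1.
  by rewrite mulr_ge0 ?exprn_ge0// subr_ge0; have := k_ge1 => ?; lra.
have : 0 <= y ^+ 2 by exact: sqr_ge0.
rewrite /gap_poly; lra.
Qed.
End HardPair.

(** * Smoothness of polynomial parametrizations *)

Section Smooth.
Variable R : realType.

Lemma cvg_horner_slope (p : {poly R}) (x : R) :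
  (h^-1 *: (p.[h + x] - p.[x]) : R^o) @[h --> (0 : R)^'] --> (deriv p).[x].
Proof.
have [dp <-] := is_derive_poly p x.
move: dp; rewrite /derivable /derive.
set f := (X in cvg (X @ _) -> _).
have -> : (fun h : R => h^-1 *: (p.[h + x] - p.[x]) : R^o) = f.
  by apply/funext => h; rewrite /f /= [h *: _]mulr1.
exact.
Qed.

(** The quotient within [[0, 1]] is a restriction of the two-sided quotient of the polynomial, which
    has a limit. *)
Lemma has_derivative_horner (f : R -> R) (p : {poly R}) (x : R) :
  (forall y, 0 <= y <= 1 -> f y = p.[y]) -> 0 <= x <= 1 ->
  has_derivative01 f x (deriv p).[x].
Proof.
move=> fp x01; rewrite /has_derivative01.
have cx : (fun y => y - x) @ x^' --> (0 : R)^'.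
  rewrite -(subrr x).
  apply: (@continuous_injective_withinNx _ _ (fun y => y - x)).
    by apply: cvgB; [exact: cvg_id|exact: cvg_cst].
  by move=> y /addIr.
have slope : (p.[y] - p.[x]) / (y - x) @[y --> x^'] --> (deriv p).[x].
  have := cvg_comp _ _ cx (@cvg_horner_slope p x).
  suff -> : (fun h : R => h^-1 *: (p.[h + x] - p.[x]) : R^o) \o
      (fun y => y - x) = (fun y => (p.[y] - p.[x]) / (y - x)) by [].
  by apply/funext => y /=; rewrite subrK [RHS]mulrC.
apply: (@cvg_trans _ ((p.[y] - p.[x]) / (y - x) @[y --> within `[0, 1] x^'])).
  apply: near_eq_cvg; rewrite near_withinE; near=> y => /=.
  by rewrite in_itv/= => y01; rewrite !fp.
exact: cvg_within_filter.
Unshelve. all: by end_near.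
Qed.

Variable m : nat.

(** This class of functions is closed under directional derivatives, so smoothness of every order
    follows by induction. *)
Definition affine_poly (p q : {poly R}) : R^o * 'rV[R]_m.+1 -> R^o :=
  fun z => p.[z.1] + q.[z.1] * z.2 0 0.

Lemma cvg_affine_poly (p q : {poly R}) (z v : R^o * 'rV[R]_m.+1) :
  h^-1 *: ((affine_poly p q \o shift z) (h *: v) - affine_poly p q z)
    @[h --> (0 : R)^'] -->
  affine_poly (v.1 *: deriv p + v.2 0 0 *: q) (v.1 *: deriv q) z.
Proof.
(* Along the line through [z] in direction [v] the function is a polynomial [P] in the step length;
   [L] is the price on that line. *)
pose L : {poly R} := v.1 *: 'X + z.1%:P.
pose P := p \Po L + (q \Po L) * (v.2 0 0 *: 'X + (z.2 0 0)%:P).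
have -> : affine_poly (v.1 *: deriv p + v.2 0 0 *: q) (v.1 *: deriv q) z
    = (deriv P).[0].
  rewrite /P /L /affine_poly.
  rewrite !(derivD, derivM, deriv_comp, derivZ, derivX, derivC).
  rewrite !(hornerE, horner_comp) /=.
  ring.
have := @cvg_horner_slope P 0.
set f := (X in X @ _ --> _ -> _); set g := (X in _ -> X @ _ --> _).
suff -> : f = g by [].
apply/funext => h; rewrite /f /g /affine_poly /P /L !(hornerE, horner_comp) /=.
rewrite !mxE.
congr (_ *: _).
by rewrite (mulrC v.1 h) (mulrC (v.2 0 0)).
Qed.

Lemma continuous_affine_poly p q : continuous (affine_poly p q).
Proof.
move=> z; apply: cvgD.
  apply: continuous_comp; [exact: cvg_fst|exact: continuous_horner].
apply: cvgM.
  apply: continuous_comp; [exact: cvg_fst|exact: continuous_horner].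
apply: (@continuous_comp _ _ _ snd (fun w : 'rV[R]_m.+1 => w 0 0)).
  exact: cvg_snd.
exact: coord_continuous.
Qed.

Lemma affine_poly_smooth (j : nat) (p q : {poly R}) :
  continuously_differentiable j setT (affine_poly p q).
Proof.
elim: j p q => [|j IH] p q; first by move=> z _; exact: continuous_affine_poly.
move=> v; split=> [z _|].
  by apply/cvg_ex; eexists; exact: cvg_affine_poly.
suff -> : 'D_v (affine_poly p q) =
    affine_poly (v.1 *: deriv p + v.2 0 0 *: q) (v.1 *: deriv q) by exact: IH.
by apply/funext => z; apply/cvg_lim => //; exact: cvg_affine_poly.
Qed.

End Smooth.

(** * Crossing number of the pair *)

Section HardFamily.
Variables (R : realType) (k : nat).
Hypothesis k_gt0 : (0 < k)%N.

(** Cut off outside [[0, 1]] to match the encoding of demand functions. *)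
Definition hard_demand (c x : R) : R :=
  if 0 <= x <= 1 then (demand_poly k c).[x] else 0.

Definition hard_family : set (R -> R) := [set hard_demand 0; hard_demand 1].

(** Matters at [c = 0] and [c = 1]; the affine interpolation makes the Lipschitz condition a direct
    estimate. *)
Definition optimal_price (c : R) : R := 1 - c * discount R k.

Lemma hard_demandE c x : 0 <= x <= 1 -> hard_demand c x = (demand_poly k c).[x].
Proof. by rewrite /hard_demand => ->. Qed.

Lemma revenue_hardE c x :
  0 <= x <= 1 -> revenue (hard_demand c) x = x * (demand_poly k c).[x].
Proof. by move=> x01; rewrite /revenue hard_demandE. Qed.

Lemma hard_demand_bounds c x : 0 <= c <= 1 -> 0 <= x <= 1 ->
  scale R k <= hard_demand c x <= 1 - 2 * scale R k.
Proof. by move=> c01 x01; rewrite hard_demandE// demand_poly_bounds. Qed.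

Lemma hard_demandB x : 0 <= x <= 1 ->
  hard_demand 1 x - hard_demand 0 x = bump R k * (1 - x) ^+ k.
Proof. by move=> x01; rewrite !hard_demandE// !demand_polyE; ring. Qed.

Lemma optimal_price0 : optimal_price 0 = 1.
Proof. by rewrite /optimal_price mul0r subr0. Qed.

Lemma optimal_price1 : optimal_price 1 = 1 - discount R k.
Proof. by rewrite /optimal_price mul1r. Qed.

Lemma optimal_price01 c : 0 <= c <= 1 -> 0 <= optimal_price c <= 1.
Proof.
move=> /andP[c0 c1]; rewrite /optimal_price.
have := discount_gt0 R k_gt0; have := discount_lt1 R k_gt0 => u1 u0.
by apply/andP; split; nra.
Qed.

Lemma revenue_hard_lt c x : c = 0 \/ c = 1 -> 0 <= x <= 1 ->
  x != optimal_price c ->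
  revenue (hard_demand c) x < revenue (hard_demand c) (optimal_price c).
Proof.
move=> c01 x01; rewrite revenue_hardE// revenue_hardE; last first.
  by apply: optimal_price01; case: c01 => ->; rewrite lexx ler01.
case: c01 => ->; last by rewrite optimal_price1; exact: revenue_lt1.
rewrite optimal_price0 => x1.
have := revenue_gap0 k x; rewrite -subr_gt0.
have := revenue_gap0 k (1 : R); rewrite subrr expr0n mulr0 => /eqP.
rewrite subr_eq0 => /eqP <- ->.
by rewrite mulr_gt0 ?scale_gt0// exprn_even_gt0//= subr_eq0 eq_sym.
Qed.

Lemma hard_maximizer c : c = 0 \/ c = 1 ->
  is_maximizer (revenue (hard_demand c)) (optimal_price c).
Proof.
move=> c01; split.
  by apply: optimal_price01; case: c01 => ->; rewrite lexx ler01.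
move=> x x01; have [->//|xp] := eqVneq x (optimal_price c).
by apply/ltW/revenue_hard_lt.
Qed.

Lemma hard_demand_family : demand_family hard_family.
Proof.
suff H c : c = 0 \/ c = 1 -> [/\ demand_function (hard_demand c),
      (forall x, 0 <= x <= 1 ->
         exists l, has_derivative01 (revenue (hard_demand c)) x l) &
      exists p, [/\ is_maximizer (revenue (hard_demand c)) p,
        (forall q, is_maximizer (revenue (hard_demand c)) q -> q = p) &
        has_derivative01 (revenue (hard_demand c)) p 0]].
  by move=> _ [->|->]; apply: H; [left|right].
move=> c01.
have c01' : 0 <= c <= 1 by case: c01 => ->; rewrite lexx ler01.
have der x : 0 <= x <= 1 ->
    has_derivative01 (revenue (hard_demand c)) x
      (deriv ('X * demand_poly k c)).[x].
  move=> x01; apply: has_derivative_horner => // y y01.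
  by rewrite revenue_hardE// !hornerE.
split.
- split => [x x01|x /negbTE x01]; last by rewrite /hard_demand x01.
  have /andP[lo hi] := hard_demand_bounds c01' x01.
  by have := scale_gt0 R k_gt0 => s0; apply/andP; split; lra.
- by move=> x x01; exists (deriv ('X * demand_poly k c)).[x]; exact: der.
- exists (optimal_price c); split; first exact: hard_maximizer.
    move=> q [q01 maxq]; apply/eqP/negPn/negP => qp.
    have := revenue_hard_lt c01 q01 qp.
    by rewrite ltNge maxq// optimal_price01.
  have := der _ (optimal_price01 c01').
  by case: c01 => ->; rewrite ?optimal_price0 ?optimal_price1
    ?deriv_revenue0 ?deriv_revenue1.
Qed.

Lemma hard_demand_inj : hard_demand 0 <> hard_demand 1.
Proof.
move=> E; have := @hard_demandB 0; rewrite lexx ler01 => /(_ isT).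
rewrite E subrr subr0 expr1n mulr1 => /esym/eqP.
by rewrite gt_eqF// bump_gt0.
Qed.

Lemma set_inj_pair (T1 T2 : Type) (f : T1 -> T2) (a b : T1) :
  f a <> f b -> set_inj [set a; b] f.
Proof.
move=> fab x y; rewrite !inE => -[->|->] [->|->]//.
by move=> /esym.
Qed.

(** Equal profiles force [(1 - p_i)^k = 0] for all [i], so all prices are 1; but there are at least
    two distinct ones. *)
Lemma hard_identifiable : identifiable k hard_family.
Proof.
move=> p p01 injp; apply: set_inj_pair => E.
have p1 i : p 0 i = 1.
  have := hard_demandB (p01 i).
  have /rowP/(_ i) := E; rewrite !mxE => ->; rewrite subrr => /esym/eqP.
  rewrite mulf_eq0 gt_eqF ?bump_gt0//= expf_eq0 subr_eq0 => /andP[_ /eqP].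
  by [].
have := injp ord0 ord_max; rewrite !p1 => /(_ erefl)/(congr1 val)/= k0.
by have := k_gt0; rewrite -k0.
Qed.

Lemma l1norm_ge (m : nat) (v : 'rV[R]_m) i : `|v 0 i| <= l1norm v.
Proof. by rewrite /l1norm (bigD1 i)//= lerDl sumr_ge0. Qed.

Lemma l1norm_ge0 (m : nat) (v : 'rV[R]_m) : 0 <= l1norm v.
Proof. exact: sumr_ge0. Qed.

Lemma l1normN (m : nat) (v : 'rV[R]_m) : l1norm (- v) = l1norm v.
Proof. by apply: eq_bigr => i _; rewrite mxE normrN. Qed.

Lemma l1norm0 (m : nat) : l1norm (0 : 'rV[R]_m) = 0.
Proof. by apply: big1 => i _; rewrite mxE normr0. Qed.

Lemma l1norm_gt0 (m : nat) (v : 'rV[R]_m) : v <> 0 -> 0 < l1norm v.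
Proof.
move=> v0; rewrite lt_neqAle l1norm_ge0 andbT eq_sym; apply/eqP => v00.
apply: v0; apply/rowP => i; rewrite mxE; apply/eqP.
by rewrite -normr_le0 -v00 l1norm_ge.
Qed.

Lemma dispersion_le (m : nat) (p : 'rV[R]_m) i j :
  i != j -> dispersion p <= `|p 0 i - p 0 j|.
Proof. by move=> ij; apply: (bigmin_le_cond _ (j := (i, j))). Qed.

(** The smaller of two prices lies below 1 by at least the dispersion, and the demand gap at that
    price alone suffices. *)
Lemma hard_profile_gap (p : 'rV[R]_k.+1) : in_cube p -> 0 <= dispersion p ->
  bump R k * dispersion p ^+ k <=
  l1norm (profile p (hard_demand 1) - profile p (hard_demand 0)).
Proof.
move=> p01 disp0.
have [i] : exists i, dispersion p <= 1 - p 0 i.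
  have := dispersion_le p (i := ord0) (j := ord_max).
  rewrite -val_eqE/= eq_sym -lt0n k_gt0 => /(_ isT).
  have /andP[_ a1] := p01 ord0; have /andP[_ b1] := p01 ord_max.
  have [ab|/ltW ab] := leP (p 0 ord0) (p 0 ord_max).
    rewrite distrC ger0_norm ?subr_ge0// => H; exists ord0.
    by apply: le_trans H _; lra.
  rewrite ger0_norm ?subr_ge0// => H; exists ord_max.
  by apply: le_trans H _; lra.
move=> Hi; apply: le_trans (l1norm_ge _ i); rewrite !mxE hard_demandB//.
rewrite ger0_norm; last first.
  apply: mulr_ge0; first exact/ltW/bump_gt0.
  rewrite exprn_ge0// subr_ge0.
  by have /andP[] := p01 i.
by rewrite ler_pM2l ?bump_gt0// lerXn2r ?nnegrE// (le_trans disp0).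
Qed.

Definition hard_params : set 'rV[R]_k.+1 := [set 0; delta_mx 0 0].

Definition hard_param (theta : 'rV[R]_k.+1) : R -> R := hard_demand (theta 0 0).

Lemma hard_param0 : hard_param 0 = hard_demand 0.
Proof. by rewrite /hard_param mxE. Qed.

Lemma hard_param1 : hard_param (delta_mx 0 0) = hard_demand 1.
Proof. by rewrite /hard_param mxE !eqxx. Qed.

(** With two parameters at distance 1, the stability estimate only has to be checked on that one
    pair, where it is [hard_profile_gap]. *)
Lemma hard_robust : robust_parametrization hard_family hard_params hard_param.
Proof.
split.
- split.
  + by move=> _ [->|->]; rewrite ?hard_param0 ?hard_param1; [left|right].
  + apply: set_inj_pair; rewrite hard_param0 hard_param1.
    exact: hard_demand_inj.
  + move=> _ [->|->].
      by exists 0; [left|exact: hard_param0].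
    by exists (delta_mx 0 0); [right|exact: hard_param1].
- by apply: compactU; exact: compact_set1.
- exists setT.
  (* The interpolation [d0 + theta_0 (d1 - d0)] is a smooth extension to the whole space. *)
  exists (affine_poly (demand_poly k 0) (demand_poly k 1 - demand_poly k 0)).
  split => //; first exact: openT.
    exact: affine_poly_smooth.
  move=> x theta x01 _; rewrite /affine_poly /= /hard_param hard_demandE//.
  by rewrite hornerD hornerN !demand_polyE; ring.
- exists (fun theta => optimal_price (theta 0 0)); split.
    by move=> _ [->|->]; apply: hard_maximizer; rewrite mxE ?eqxx; [left|right].
  have PF : ProperFilter (globally (hard_params `*` hard_params)).
    by apply: (@globally_properfilter _ _ (0, 0)); split; left.
  (* Lipschitz constant 1 suffices because [discount < 1]. *)
  apply: (@klipschitzW _ _ _ 1) => -[x y] /= _.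
  rewrite /optimal_price mul1r.
  have -> : 1 - x 0 0 * discount R k - (1 - y 0 0 * discount R k) =
            - (discount R k * (x - y) 0 0) by rewrite !mxE; ring.
  have u0 := discount_gt0 R k_gt0; have /ltW u1 := discount_lt1 R k_gt0.
  rewrite normrN normrM gtr0_norm//.
  apply: (@le_trans _ _ `|(x - y) 0 0|); first by rewrite ler_piMl.
  rewrite [leRHS]/Num.norm /= mx_normrE; apply/bigmax_geP; right => /=.
  by exists (0, 0).
exists 1, ((bump R k)^-1); split => //; first by rewrite invr_gt0 bump_gt0.
move=> p theta theta' p01 th th' y y' /(_ k_gt0)[/andP[disp0 _] _].
have b0 := bump_gt0 R k_gt0.
have key : l1norm (delta_mx 0 0 : 'rV[R]_k.+1) <= (bump R k)^-1 *
    l1norm (profile p (hard_demand 1) - profile p (hard_demand 0)) /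
    dispersion p ^+ k.
  have -> : l1norm (delta_mx 0 0 : 'rV[R]_k.+1) = 1.
    rewrite /l1norm (bigD1 0)//= mxE !eqxx normr1 big1 ?addr0// => i i0.
    by rewrite mxE (negbTE i0) andbF normr0.
  rewrite ler_pdivlMr ?exprn_gt0// mul1r ler_pdivlMl//.
  by apply: hard_profile_gap => //; exact: ltW.
have nn (v : 'rV[R]_k.+1) : 0 <= (bump R k)^-1 * l1norm v / dispersion p ^+ k.
  by rewrite !mulr_ge0 ?l1norm_ge0 ?invr_ge0 ?exprn_ge0 ?ltW.
move: th th'; rewrite /y /y' => -[->|->] [->|->].
- by rewrite subrr l1norm0 nn.
- by rewrite sub0r l1normN hard_param0 hard_param1 -opprB l1normN.
- by rewrite subr0 hard_param0 hard_param1.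
- by rewrite subrr l1norm0 nn.
Qed.

(** * Lower orders excluded by prices clustering at 1 *)

Definition arithmetic_prices (j : nat) (e : R) : 'rV[R]_j.+1 :=
  \row_i (1 - i%:R * e).

Lemma arithmetic_prices_cube j e : 0 <= e -> j%:R * e <= 1 ->
  in_cube (arithmetic_prices j e).
Proof.
move=> e0 je i; rewrite mxE.
have : i%:R * e <= j%:R * e by rewrite ler_wpM2r// ler_nat -ltnS.
have : 0 <= i%:R * e by rewrite mulr_ge0.
by move=> *; apply/andP; split; lra.
Qed.

Lemma arithmetic_prices_dispersion j e : (0 < j)%N -> 0 < e <= 1 ->
  dispersion (arithmetic_prices j e) = e.
Proof.
move=> j0 /andP[e0 e1]; apply/eqP; rewrite eq_le; apply/andP; split.
  have j1 : (1 < j.+1)%N by [].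
  have := @dispersion_le _ (arithmetic_prices j e) ord0 (Ordinal j1) isT.
  by rewrite !mxE mul0r subr0 mul1r opprB addrC subrK gtr0_norm.
(* The default value 1 of the minimum is where [e <= 1] enters. *)
apply: le_bigmin => // -[i i'] /= ii'; rewrite !mxE.
have -> : 1 - i%:R * e - (1 - i'%:R * e) = (i'%:R - i%:R) * e by ring.
rewrite normrM (gtr0_norm e0); apply: ler_peMl; first exact: ltW.
rewrite -val_eqE/= in ii'.
have [H|H|/esym/eqP] := ltgtP (i : nat) i'; last by rewrite eq_sym (negbTE ii').
  by apply: le_trans (ler_norm _); rewrite lerBrDr addrC natr1 ler_nat.
rewrite distrC; apply: le_trans (ler_norm _).
by rewrite lerBrDr addrC natr1 ler_nat.
Qed.

(** All prices are within [j e] of 1, where the demand gap is at most [bump (j e)^k]. *)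
Lemma arithmetic_profile_gap j e : 0 <= e -> j%:R * e <= 1 ->
  l1norm (profile (arithmetic_prices j e) (hard_demand 1) -
          profile (arithmetic_prices j e) (hard_demand 0)) <=
  j.+1%:R * bump R k * j%:R ^+ k * e ^+ k.
Proof.
move=> e0 je; have p01 := arithmetic_prices_cube e0 je.
have -> : j.+1%:R * bump R k * j%:R ^+ k * e ^+ k =
    \sum_(i < j.+1) bump R k * (j%:R * e) ^+ k.
  by rewrite sumr_const card_ord exprMn -[RHS]mulr_natl !mulrA.
apply: ler_sum => i _; have := p01 i.
rewrite !mxE => pi; rewrite hard_demandB// opprB addrC subrK.
have ie : 0 <= i%:R * e by rewrite mulr_ge0.
have b0 := bump_gt0 R k_gt0.
rewrite ger0_norm; last by apply: mulr_ge0; [exact: ltW|exact: exprn_ge0].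
rewrite ler_pM2l// lerXn2r ?nnegrE ?mulr_ge0//.
by rewrite ler_wpM2r// ler_nat -ltnS.
Qed.

(** The single price 1 does not separate the pair. *)
Lemma hard_not_identifiable0 : ~ identifiable 0 hard_family.
Proof.
move=> /(_ (const_mx 1)) H; apply: hard_demand_inj.
apply: H; rewrite ?inE; [|by move=> i i' _; rewrite !ord1|by left|by right|].
  by move=> i; rewrite mxE ler01 lexx.
apply/rowP => i; rewrite !mxE; apply/eqP; rewrite eq_sym -subr_eq0.
by rewrite hard_demandB ?ler01 ?lexx// subrr expr0n (gtn_eqF k_gt0) mulr0.
Qed.

(** On arithmetic prices of step [e], stability of order [j] bounds the fixed parameter distance
    [L > 0] by a constant times [e^(k-j)], which is false for small [e]. *)
Lemma hard_not_robust j : (0 < j < k)%N ->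
  forall Theta (d : 'rV[R]_j.+1 -> R -> R),
  ~ robust_parametrization hard_family Theta d.
Proof.
move=> /andP[j0 jk] Theta d [[_ _ surj] _ _ _ [c1 [c2 [c1_gt0 c2_gt0 stab]]]].
have [t0 T0 dt0] := surj (hard_demand 0) (or_introl erefl).
have [t1 T1 dt1] := surj (hard_demand 1) (or_intror erefl).
set L := l1norm (t1 - t0).
have L0 : 0 < L.
  apply: l1norm_gt0 => /eqP; rewrite subr_eq0 => /eqP t01.
  by apply: hard_demand_inj; rewrite -dt0 -dt1 t01.
pose M := j.+1%:R * bump R k * j%:R ^+ k.
have j1 : 1 <= j%:R :> R by rewrite ler1n.
have b0 := bump_gt0 R k_gt0.
have M0 : 0 < M.
  apply: mulr_gt0; last by rewrite exprn_gt0// ltr0n.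
  by apply: mulr_gt0; rewrite ?ltr0n.
(* With [e = 1/S], the summands enforce in turn [j e <= 1], [e <= c1], [M e <= c1] and
   [2 c2 M e <= L]. *)
pose S := j%:R + c1^-1 + M / c1 + 2 * c2 * M / L.
have c1V : 0 < c1^-1 by rewrite invr_gt0.
have Mc : 0 < M / c1 by rewrite divr_gt0.
have c2M : 0 < c2 * M by exact: mulr_gt0.
have ML : 0 < 2 * c2 * M / L by rewrite -(mulrA 2) divr_gt0// mulr_gt0.
have S0 : 0 < S by rewrite /S; lra.
pose e := S^-1.
have e0 : 0 < e by rewrite invr_gt0.
have eS x : x <= S -> x * e <= 1 by move=> xS; rewrite ler_pdivrMr// mul1r.
have je : j%:R * e <= 1 by apply: eS; rewrite /S; lra.
have e1 : e <= 1 by apply: le_trans je; rewrite ler_peMl// ltW.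
have ec : e <= c1.
  have : c1^-1 * e <= 1 by apply: eS; rewrite /S; lra.
  by rewrite mulrC ler_pdivrMr// mul1r.
have Mec : M * e <= c1.
  have : M / c1 * e <= 1 by apply: eS; rewrite /S; lra.
  by rewrite mulrAC ler_pdivrMr// mul1r.
have MeL : 2 * (c2 * (M * e)) <= L.
  have : 2 * c2 * M / L * e <= 1 by apply: eS; rewrite /S; lra.
  by rewrite mulrAC ler_pdivrMr// mul1r !mulrA.
have disp : dispersion (arithmetic_prices j e) = e.
  by apply: arithmetic_prices_dispersion; rewrite ?e0.
have gap := arithmetic_profile_gap (ltW e0) je.
have := stab _ _ _ (arithmetic_prices_cube (ltW e0) je) T1 T0.
rewrite /= dt0 dt1 disp -/L => H.
have expe i : (0 < i)%N -> e ^+ i <= e.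
  by move=> i0; rewrite -(prednK i0) exprS ler_piMr ?exprn_ile1// ltW.
have {H} : L <= c2 * (M * e ^+ k) / e ^+ j.
  apply: le_trans (H _) _.
    move=> _; rewrite e0 ec; split=> //; apply: le_trans gap _.
    by apply: le_trans Mec; rewrite -/M ler_pM2l// expe.
  by rewrite ler_pM2r ?invr_gt0 ?exprn_gt0// ler_pM2l.
rewrite -(subnK (ltnW jk)) exprD !mulrA mulfK ?gt_eqF ?exprn_gt0// => H.
have : c2 * M * e ^+ (k - j) <= c2 * M * e.
  by rewrite ler_pM2l// expe// subn_gt0.
move: MeL; rewrite !mulrA; lra.
Qed.

Lemma hard_k_crossing : k_crossing k hard_family.
Proof.
split.
  split; first exact: hard_identifiable.
  by exists hard_params, hard_param; exact: hard_robust.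
move=> j [idj [Th [d rob]]]; rewrite leqNgt; apply/negP => jk.
have [j0|j0] := posnP j; last by apply: hard_not_robust rob; rewrite j0.
by move: idj; rewrite j0; exact: hard_not_identifiable0.
Qed.

End HardFamily.

(** * Change of measure for adaptive policies *)

Section RealInequalities.
Variable R : realFieldType.
Implicit Types x y a b c e : R.

Lemma cauchy_schwarz2 x y a b c e :
  0 <= a -> 0 <= b -> 0 <= c -> 0 <= e ->
  x ^+ 2 <= a * b -> y ^+ 2 <= c * e -> (x + y) ^+ 2 <= (a + c) * (b + e).
Proof.
move=> a0 b0 c0 e0 xab yce.
(* Arithmetic-geometric mean: [(2xy)^2 <= 4 (ae)(cb) <= (ae + cb)^2]. *)
have xy : x * y *+ 2 <= a * e + c * b.
  apply: le_trans (ler_norm _) _.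
  rewrite -ler_sqr ?nnegrE ?addr_ge0 ?mulr_ge0// real_normK ?num_real//.
  have : x ^+ 2 * y ^+ 2 <= (a * b) * (c * e) by rewrite ler_pM ?sqr_ge0.
  have := sqr_ge0 (a * e - c * b); nra.
rewrite sqrrD; nra.
Qed.

(** One observation with success probabilities [p] and [q] splits a cell of masses [a0], [a1] in
    two; [u], [u'] and [v], [v'] are the masses of the restricted event in the halves. Dividing by
    [a1] reduces the claim to Cauchy-Schwarz. *)
Lemma chi2_step (a0 a1 u v u' v' p q r K : R) :
  0 <= a1 -> 0 <= v -> 0 <= v' -> 0 <= r -> 0 < q < 1 ->
  p ^+ 2 / q + (1 - p) ^+ 2 / (1 - q) <= K ->
  u ^+ 2 * (q * a1) <= r * v * (p * a0) ^+ 2 ->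
  u' ^+ 2 * ((1 - q) * a1) <= r * v' * ((1 - p) * a0) ^+ 2 ->
  (u + u') ^+ 2 * a1 <= K * r * (v + v') * a0 ^+ 2.
Proof.
rewrite le_eqVlt => /predU1P[<-|a1_gt0] v0 v'0 r0 /andP[q0 q1] chiK uv u'v'.
  rewrite mulr0; apply: mulr_ge0; last exact: sqr_ge0.
  apply: mulr_ge0; last exact: addr_ge0.
  apply: mulr_ge0 => //; apply: le_trans chiK.
  apply: addr_ge0; apply: divr_ge0; rewrite ?sqr_ge0 ?ltW//.
  by rewrite subr_gt0.
have q1' : 0 < 1 - q by rewrite subr_gt0.
rewrite -ler_pdivlMr//.
have uE : u ^+ 2 <= p ^+ 2 / q * (r * v * a0 ^+ 2 / a1).
  rewrite mulf_div ler_pdivlMr ?mulr_gt0//; apply: le_trans uv _.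
  by rewrite le_eqVlt; apply/orP; left; apply/eqP; ring.
have u'E : u' ^+ 2 <= (1 - p) ^+ 2 / (1 - q) * (r * v' * a0 ^+ 2 / a1).
  rewrite mulf_div ler_pdivlMr ?mulr_gt0//; apply: le_trans u'v' _.
  by rewrite le_eqVlt; apply/orP; left; apply/eqP; ring.
have w0 z : 0 <= z -> 0 <= r * z * a0 ^+ 2 / a1.
  move=> z0; apply: divr_ge0; last exact: ltW.
  by apply: mulr_ge0; rewrite ?sqr_ge0 ?mulr_ge0.
apply: le_trans (cauchy_schwarz2 _ (w0 _ v0) _ (w0 _ v'0) uE u'E) _.
- by apply: divr_ge0; rewrite ?sqr_ge0// ltW.
- by apply: divr_ge0; rewrite ?sqr_ge0// ltW.
have -> : r * v * a0 ^+ 2 / a1 + r * v' * a0 ^+ 2 / a1 =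
          r * (v + v') * a0 ^+ 2 / a1 by ring.
have -> : K * r * (v + v') * a0 ^+ 2 / a1 = K * (r * (v + v') * a0 ^+ 2 / a1).
  by ring.
by apply: ler_wpM2r => //; apply/w0/addr_ge0.
Qed.

(** The left side is the second moment, under Bernoulli [q], of the likelihood ratio of Bernoulli
    [p] to it; the excess over 1 is the chi-square divergence. *)
Lemma chi2_bernoulli (p q : R) : 0 < q < 1 ->
  p ^+ 2 / q + (1 - p) ^+ 2 / (1 - q) = 1 + (q - p) ^+ 2 / (q * (1 - q)).
Proof.
move=> /andP[q0 q1]; field.
by rewrite subr_eq0 (gt_eqF q1) (gt_eqF q0).
Qed.

End RealInequalities.

(** * Histories as functions of past demands *)

Section Policy.
Variables (R : realType) (disp : measure_display) (Omega : measurableType disp).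
Variables (n : nat) (X : 'I_n -> Omega -> R) (D : 'I_n -> Omega -> bool).
Hypothesis policyX : is_policy X D.

Definition same_demands (t : nat) (w w' : Omega) : Prop :=
  forall s : 'I_n, (s < t)%N -> D s w = D s w'.

(** A policy has no randomness of its own: past prices are functions of still earlier demands. By
    strong induction on [t] the generators are saturated, and saturated sets form a
    sigma-algebra. *)
Lemma history_saturated (t : 'I_n) (A : set Omega) w w' :
  history X D t A -> same_demands t w w' -> A w <-> A w'.
Proof.
have [m] := ubnP (nat_of_ord t); elim: m t A w w' => // m IH t A w w' tm.
pose S := [set B : set Omega |
  forall u v, same_demands t u v -> B u <-> B v].
suff HS : history X D t `<=` S by move=> hA ww'; exact: (HS _ hA).
apply: smallest_sub.
  split => //.
  - move=> B SB u v uv; split=> -[_ nB]; split=> // Bx; apply: nB.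
      by apply/(SB _ _ uv).
    by apply/(SB _ _ uv).
  - move=> F SF u v uv; split=> -[i _ Fi]; exists i => //.
      by apply/(SF _ _ _ uv).
    by apply/(SF _ _ _ uv).
move=> _ [s /= st [[B mB <-]|[B mB <-]]] u v uv;
  rewrite setTI/=; last by rewrite uv.
apply: (IH s (X s @^-1` B)).
- by apply: leq_trans st _; rewrite -ltnS.
- by have [_ /(_ s B mB)] := policyX.
- by move=> i /ltn_trans/(_ st); exact: uv.
Qed.

Lemma policy_const (t : 'I_n) w w' : same_demands t w w' -> X t w = X t w'.
Proof.
move=> ww'; have [_ /(_ t [set X t w'] (measurable_set1 _)) hX] := policyX.
by apply/(history_saturated hX ww').
Qed.

Lemma history_demand (s t : 'I_n) (b : bool) : (s < t)%N ->
  history X D t (D s @^-1` [set b]).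
Proof.
move=> st; apply: sub_sigma_algebra; exists s => //; right.
by exists [set b] => //; rewrite setTI.
Qed.

Lemma historyI (t : 'I_n) A B :
  history X D t A -> history X D t B -> history X D t (A `&` B).
Proof.
pose G := \bigcup_(s in [set s : 'I_n | (s < t)%N])
  (preimage_set_system setT (X s) measurable `|`
   preimage_set_system setT (D s) measurable).
exact: (@measurableI _ (g_sigma_algebraType G)).
Qed.

Section Model.
Variables (P : probability Omega R) (d : R -> R).
Hypothesis modelP : demand_model X D P d.

(** Strong induction on the round: price events lie in earlier histories, demand events are
    measurable by the model. *)
Lemma history_measurable (t : 'I_n) : history X D t `<=` measurable.
Proof.
have [m] := ubnP (nat_of_ord t); elim: m t => // m IH t tm.
apply: smallest_sub; first exact: sigma_algebra_measurable.
move=> _ [s /= st [[B mB <-]|[B mB <-]]].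
  rewrite setTI; apply: (IH s); first by apply: leq_trans st _; rewrite -ltnS.
  by have [_] := policyX; exact.
by have [+ _] := modelP => /(_ s); exact.
Qed.

Lemma policy_measurable (t : 'I_n) : measurable_fun setT (X t).
Proof.
move=> _ B mB; rewrite setTI; apply: (@history_measurable t).
by have [_] := policyX; exact.
Qed.

Lemma demand_measurable (t : 'I_n) (b : bool) : measurable (D t @^-1` [set b]).
Proof.
by rewrite -[X in measurable X]setTI; have [+ _] := modelP => /(_ t); exact.
Qed.

Lemma prob_demand_split (t : 'I_n) (A : set Omega) : measurable A ->
  fine (P A) = fine (P (A `&` D t @^-1` [set true])) +
               fine (P (A `&` D t @^-1` [set false])).
Proof.
move=> mA; have mD b : measurable (A `&` D t @^-1` [set b]).
  by apply: measurableI => //; exact: demand_measurable.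
rewrite -fineD ?fin_num_measure// -measureU//.
  rewrite -setIUr (_ : _ `|` _ = setT) ?setIT//.
  by apply/seteqP; split => // w _ /=; case: (D t w); [left|right].
by apply/seteqP; split => // w [[_ /= ->] [_ /=]].
Qed.

(** The price is constant on [C], so the integral in the model is that of a constant. *)
Lemma demand_prob (t : 'I_n) (C : set Omega) (x : R) :
  history X D t C -> (forall w, C w -> X t w = x) ->
  fine (P (C `&` D t @^-1` [set true])) = d x * fine (P C).
Proof.
move=> hC Cx; have mC := history_measurable hC.
have [_ ->//] := modelP.
rewrite (eq_integral (cst (d x)%:E)); last first.
  by move=> w; rewrite inE => /Cx ->.
by rewrite integral_cst// fineM// fin_num_measure.
Qed.

Lemma demand_probC (t : 'I_n) (C : set Omega) (x : R) :
  history X D t C -> (forall w, C w -> X t w = x) ->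
  fine (P (C `&` D t @^-1` [set false])) = (1 - d x) * fine (P C).
Proof.
move=> hC Cx; have mC := history_measurable hC.
rewrite mulrBl mul1r -(demand_prob hC Cx) (prob_demand_split t mC).
by rewrite addrAC subrr add0r.
Qed.

End Model.

(** A node, possibly empty, of the tree of demand outcomes. Membership in all histories from [t] on
    is what passes to the children. *)
Definition cell (t : nat) (C : set Omega) : Prop :=
  (forall w w', C w -> C w' -> same_demands t w w') /\
  (forall u : 'I_n, (t <= u)%N -> history X D u C).

Lemma cellT : cell 0 setT.
Proof.
by split=> // u _; exact: (@measurableT _ (g_sigma_algebraType _)).
Qed.

Lemma cell_child (t : 'I_n) (C : set Omega) (b : bool) :
  cell t C -> cell t.+1 (C `&` D t @^-1` [set b]).
Proof.
move=> [sC hC]; split=> [w w' [Cw /= Dw] [Cw' /= Dw'] s|u tu].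
  rewrite ltnS leq_eqVlt => /predU1P[/val_inj ->|]; first by rewrite Dw Dw'.
  exact: sC.
by apply: historyI; [apply: hC; exact: ltnW|exact: history_demand].
Qed.

(** * Second moment of the likelihood ratio along the tree *)

Section ChangeOfMeasure.
Variables (P0 P1 : probability Omega R) (d0 d1 : R -> R).
Hypotheses (model0 : demand_model X D P0 d0) (model1 : demand_model X D P1 d1).
Variables (K : R) (top : set R) (m : 'I_n).
Hypothesis mtop : measurable top.
Hypothesis chi2_top : forall x, 0 <= x <= 1 -> top x ->
  0 < d1 x < 1 /\ d0 x ^+ 2 / d1 x + (1 - d0 x) ^+ 2 / (1 - d1 x) <= K.
Hypothesis K_ge0 : 0 <= K.

Definition stays : set Omega :=
  [set w | forall s : 'I_n, (s < m)%N -> top (X s w)].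

Lemma measurable_stays : measurable stays.
Proof.
have -> : stays = \bigcap_(s in [set s : 'I_n | (s < m)%N]) (X s @^-1` top).
  by apply/seteqP; split.
apply: fin_bigcap_measurable => [|s _]; first exact: finite_finset.
by rewrite -[X in measurable X]setTI; exact: (policy_measurable model0).
Qed.

Lemma stays_saturated w w' : same_demands m w w' -> stays w -> stays w'.
Proof.
move=> ww' Sw s sm; rewrite -(@policy_const s w w'); first exact: Sw.
by move=> i /ltn_trans/(_ sm); exact: ww'.
Qed.

(* Cauchy-Schwarz for the restriction of the likelihood ratio to [stays],
   conditionally on [C]; prices are constant on a cell, so one round multiplies
   the second moment of the likelihood ratio by at most [K]. *)
Lemma cell_change_of_measure (j t : nat) (C : set Omega) :
  (t + j = m)%N -> cell t C ->
  fine (P0 (C `&` stays)) ^+ 2 * fine (P1 C) <=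
  K ^+ j * fine (P1 (C `&` stays)) * fine (P0 C) ^+ 2.
Proof.
elim: j t C => [|j IH] t C tjm cellC.
  (* At depth [m] the cell fixes all demands on which [stays] depends, so it lies inside [stays] or
     misses it. *)
  have [->|->] : C `&` stays = C \/ C `&` stays = set0.
  - have [->|/set0P[w [Cw Sw]]] := eqVneq (C `&` stays) set0; first by right.
    left; apply/seteqP; split => [w' []//|w' Cw']; split=> //.
    apply: stays_saturated Sw; move: tjm; rewrite addn0 => <-.
    exact: cellC.1.
  - by rewrite expr0 mul1r mulrC.
  - rewrite measure0 expr0n mul0r mul1r mulr_ge0 ?sqr_ge0//.
    by rewrite measure0.
have tm : (t < m)%N by rewrite -tjm addnS ltnS leq_addr.
pose T := Ordinal (ltn_trans tm (ltn_ord m)).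
have [->|/set0P[w Cw]] := eqVneq C set0.
  by rewrite !set0I !measure0/= !mulr0 expr0n mulr0.
have hC : history X D T C by exact: cellC.2.
have Cx w' : C w' -> X T w' = X T w.
  by move=> Cw'; apply: policy_const; exact: cellC.1.
have X01 : 0 <= X T w <= 1 by exact: policyX.1.
have b0 : 0 <= fine (P1 (C `&` stays)) by rewrite fine_ge0.
(* If the common price leaves [top] now, no point of the cell is in [stays] and both sides
   vanish. *)
have [topw|ntopw] := pselect (top (X T w)); last first.
  have -> : C `&` stays = set0.
    apply/seteqP; split => // w' [Cw' /(_ T tm)].
    by rewrite (Cx _ Cw').
  rewrite !measure0 expr0n mul0r mulr0 mul0r.
  by [].
have mC := history_measurable model0 hC.
have mCS : measurable (C `&` stays).
  by apply: measurableI => //; exact: measurable_stays.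
rewrite (prob_demand_split model0 T mCS) (prob_demand_split model1 T mCS).
have [q01 chiK] := chi2_top X01 topw.
have ge0 (P : probability Omega R) A : 0 <= fine (P A) by rewrite fine_ge0.
rewrite (exprS K); apply: (chi2_step (q := d1 (X T w)) (p := d0 (X T w))) => //.
- exact: exprn_ge0.
- have := IH t.+1 (C `&` D T @^-1` [set true]).
  rewrite (demand_prob model0 hC Cx) (demand_prob model1 hC Cx).
  rewrite -!(setIAC C stays); apply; first by rewrite addSn -addnS.
  exact: (@cell_child T).
- have := IH t.+1 (C `&` D T @^-1` [set false]).
  rewrite (demand_probC model0 hC Cx) (demand_probC model1 hC Cx).
  rewrite -!(setIAC C stays); apply; first by rewrite addSn -addnS.
  exact: (@cell_child T).
Qed.

Lemma change_of_measure :
  fine (P0 stays) ^+ 2 <= K ^+ m * fine (P1 stays).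
Proof.
have := cell_change_of_measure (add0n m) cellT.
by rewrite !setTI !probability_setT/= expr1n !mulr1.
Qed.

End ChangeOfMeasure.
End Policy.

(** Integrates a pathwise revenue shortfall of [c] on [B]. An almost sure bound is enough, as the
    markdown property only holds almost surely. *)
Lemma regret_ge (R : realType) (disp : measure_display)
    (Omega : measurableType disp) (n : nat) (X : 'I_n -> Omega -> R)
    (P : probability Omega R) (d : R -> R) (p c : R) (B : set Omega) :
  (forall t w, 0 <= X t w <= 1) ->
  (forall t, measurable_fun setT (fun w => revenue d (X t w))) ->
  (forall x, 0 <= x <= 1 -> 0 <= revenue d x) ->
  is_maximizer (revenue d) p ->
  0 <= c -> measurable B ->
  {ae P, forall w, \sum_(t < n) revenue d (X t w) + c * \1_B w
                   <= n%:R * revenue d p} ->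
  ((c * fine (P B))%:E <= regret X P d)%E.
Proof.
move=> X01 mr r0 [p01 maxp] c0 mB leB.
set f : Omega -> R := fun w => \sum_(t < n) revenue d (X t w).
have f0 w : 0 <= f w by apply: sumr_ge0 => t _; exact: r0.
have mf : measurable_fun setT f by exact: measurable_sum.
have le_sup : revenue d p <= sup [set revenue d p | p in `[0, 1]].
  apply: ub_le_sup; last by exists p => //=; rewrite in_itv.
  by exists (revenue d p) => _ [x /= + <-]; rewrite in_itv/=; exact: maxp.
have le_int : ('E_P[f] + (c * fine (P B))%:E <= (n%:R * revenue d p)%:E)%E.
  rewrite unlock.
  have -> : (c * fine (P B))%:E = (\int[P]_w (c * \1_B w)%:E)%E.
    rewrite EFinM fineK ?fin_num_measure//.
    rewrite -[X in P X](setIT B) -integral_indic// -ge0_integralZl//.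
    by apply: measurableT_comp.
  rewrite -ge0_integralD//.
  - rewrite -[leRHS]mule1 -(@probability_setT _ _ _ P) -integral_cst//.
    apply: ae_ge0_le_integral => //.
    - by move=> w _; rewrite adde_ge0// lee_fin// mulr_ge0.
    - apply: emeasurable_funD; first exact: measurableT_comp.
      by apply: measurableT_comp => //; exact: measurable_funM.
    - by move=> w _; rewrite lee_fin mulr_ge0// r0.
    by apply: filterS leB => w lew _; rewrite -EFinD lee_fin.
  - by move=> w _; rewrite lee_fin.
  - exact: measurableT_comp.
  - by move=> w _; rewrite lee_fin mulr_ge0.
  - by apply: measurableT_comp => //; exact: measurable_funM.
have E0 : (0 <= 'E_P[f])%E by exact: expectation_ge0.
rewrite /regret -/f; move: le_int E0.
(* The upper bound excludes [+oo] and nonnegativity excludes [-oo]. *)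
case: ('E_P[f])%E => [e| |]//= le_int _.
rewrite -EFinB lee_fin; move: le_int; rewrite -EFinD lee_fin => le_int.
have : n%:R * revenue d p <= n%:R * sup [set revenue d p | p in `[0, 1]].
  by rewrite ler_wpM2l.
lra.
Qed.

(** * Regret lower bound *)

Lemma sum_ord_lt (R : pzSemiRingType) (m n : nat) : (m <= n)%N ->
  \sum_(t < n) (t < m)%:R = m%:R :> R.
Proof.
move=> mn; rewrite (eq_bigr (fun t : 'I_n => if (t < m)%N then 1 else 0)).
  by rewrite -big_mkcond -(big_ord_widen n (fun=> 1))// sumr_const card_ord.
by move=> t _; case: ifP.
Qed.

Lemma sum_ord_ge (R : pzRingType) (m n : nat) : (m <= n)%N ->
  \sum_(t < n) (m <= t)%:R = n%:R - m%:R :> R.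
Proof.
move=> mn; rewrite -[in RHS](sum_ord_lt _ (leqnn n)) -[in RHS](sum_ord_lt _ mn).
rewrite -sumrB; apply: eq_bigr => t _; rewrite ltn_ord leqNgt.
by case: (t < m)%N; rewrite /= ?subrr ?subr0.
Qed.

Lemma measurable_gt (R : realType) (a : R) : measurable [set x | a < x].
Proof.
rewrite (_ : [set x | _] = `]a, +oo[%classic)//.
by apply/seteqP; split => x /=; rewrite in_itv/= andbT.
Qed.

(** * Width of the price window *)

Section Horizon.
Variables (R : realType) (k : nat) (n : nat).
Hypothesis n_gt0 : (0 < n)%N.

Definition window : R := n%:R `^ (- (2 * k.+1%:R)^-1).

Lemma window_gt0 : 0 < window.
Proof. by rewrite /window powR_gt0// ltr0n. Qed.

Lemma window_pow : n%:R * window ^+ (2 * k.+1) = 1.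
Proof.
have n0 : n%:R != 0 :> R by rewrite pnatr_eq0 -lt0n.
rewrite -powR_mulrn ?ltW ?window_gt0// /window -powRrM natrM.
by rewrite mulNr mulVf ?powR_inv1// ?mulfV// mulf_neq0 ?pnatr_eq0.
Qed.

Lemma window_sqr : n%:R * window ^+ 2 = n%:R `^ (k%:R / k.+1%:R).
Proof.
have n0 : n%:R != 0 :> R by rewrite pnatr_eq0 -lt0n.
have k0 : k.+1%:R != 0 :> R by rewrite pnatr_eq0.
rewrite -powR_mulrn ?ltW ?window_gt0// /window -powRrM.
rewrite -[X in X * _](powRr1 (ler0n R n)) -powRD; last by rewrite n0 implybT.
congr (_ `^ _).
have -> : k%:R = k.+1%:R - 1 :> R by rewrite -natr1 addrK.
by field.
Qed.

Lemma window_le (b : R) : 0 < b -> (b^-1) ^+ (2 * k.+1) <= n%:R -> window <= b.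
Proof.
move=> b0; rewrite exprVn => bn.
have n0 : 0 < n%:R :> R by rewrite ltr0n.
have w0 := window_gt0.
have [//|bw] := leP window b.
have : b ^+ (2 * k.+1) < window ^+ (2 * k.+1).
  by rewrite ltrXn2r// ltW.
rewrite -(ltr_pM2l n0) window_pow => /lt_le_trans.
move: bn; rewrite -[X in X <= _]mul1r ler_pdivrMr ?exprn_gt0// => bn /(_ _ bn).
by rewrite ltxx.
Qed.

End Horizon.

(** * Costs of staying in the window and of leaving it *)

Section LowerBound.
Variables (R : realType) (k : nat).
Hypothesis k_gt0 : (0 < k)%N.

(** The divergence is [(bump (1 - x)^k)^2 / (q (1 - q))], with [q (1 - q) >= scale^2] and
    [bump = ratio scale]. *)
Lemma chi2_top (h x : R) : 0 <= x <= 1 -> 1 - h < x ->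
  let p := hard_demand k 0 x in let q := hard_demand k 1 x in
  0 < q < 1 /\
  p ^+ 2 / q + (1 - p) ^+ 2 / (1 - q) <= 1 + ratio R k ^+ 2 * h ^+ (2 * k).
Proof.
move=> x01 xh p q.
have s0 := scale_gt0 R k_gt0.
have : scale R k <= q <= 1 - 2 * scale R k.
  by apply: hard_demand_bounds => //; rewrite lexx ler01.
move=> /andP[qlo qhi].
have q01 : 0 < q < 1 by apply/andP; split; lra.
split=> //; rewrite chi2_bernoulli// lerD2l.
have -> : q - p = bump R k * (1 - x) ^+ k by exact: hard_demandB.
have q0 : 0 < q * (1 - q) by apply: mulr_gt0; lra.
have E : (bump R k * (1 - x) ^+ k) ^+ 2 =
    ratio R k ^+ 2 * (((1 - x) ^+ k) ^+ 2 * scale R k ^+ 2).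
  by rewrite /bump; ring.
rewrite ler_pdivrMr// E -[leRHS]mulrA ler_wpM2l ?sqr_ge0// (mulnC 2 k) exprM.
move/andP: x01 => [x0 x1].
apply: ler_pM; rewrite ?sqr_ge0//.
  by rewrite lerXn2r ?nnegrE ?exprn_ge0 ?subr_ge0//
     ?lerXn2r ?nnegrE ?subr_ge0//; lra.
by rewrite expr2; apply: ler_pM; lra.
Qed.

Variables (disp : measure_display) (Omega : measurableType disp) (n : nat).
Variables (X : 'I_n -> Omega -> R) (D : 'I_n -> Omega -> bool).
Hypothesis policyX : is_policy X D.

Lemma measurable_hard_revenue (t : 'I_n) (c : R) : measurable_fun setT (X t) ->
  measurable_fun setT (fun w => revenue (hard_demand k c) (X t w)).
Proof.
move=> mX; rewrite (_ : (fun w => _) = horner ('X * demand_poly k c) \o X t).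
  apply: measurableT_comp => //; apply: continuous_measurable_fun.
  exact: continuous_horner.
by apply/funext => w /=; rewrite revenue_hardE ?policyX.1// hornerM hornerX.
Qed.

Lemma hard_revenue_ge0 (c x : R) : 0 <= c <= 1 -> 0 <= x <= 1 ->
  0 <= revenue (hard_demand k c) x.
Proof.
move=> c01 x01; have /andP[lo _] := hard_demand_bounds k_gt0 c01 x01.
have s0 := scale_gt0 R k_gt0; apply: mulr_ge0; last by lra.
by case/andP: x01.
Qed.

Lemma sum_ord_le (r : 'I_n -> R) (M : R) :
  (forall t, r t <= M) -> \sum_(t < n) r t <= n%:R * M.
Proof.
move=> rM; rewrite -[X in _ <= X%:R * _]card_ord mulr_natl -sumr_const.
exact: ler_sum.
Qed.

Lemma sum_revenue_le (w : Omega) (r : R -> R) (M g : R) (b : 'I_n -> bool) :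
  (forall t, r (X t w) + g * (b t)%:R <= M) ->
  \sum_(t < n) r (X t w) + g * \sum_(t < n) (b t)%:R <= n%:R * M.
Proof. by move=> H; rewrite mulr_sumr -big_split/=; exact: sum_ord_le. Qed.

(** On the event, each of the first [m] rounds loses at least the constant from
    [revenue_gap1_near]. *)
Lemma regret_stay (P : probability Omega R) (h : R) (m : 'I_n) :
  demand_model X D P (hard_demand k 1) ->
  h * (4 * k%:R + 2) <= 2 * discount R k ->
  ((m%:R * (scale R k * discount R k ^+ 2) *
    fine (P (stays X [set x | 1 - h < x] m)))%:E <=
   regret X P (hard_demand k 1))%E.
Proof.
move=> model hk.
have s0 := scale_gt0 R k_gt0; have u0 := discount_gt0 R k_gt0.
have g0 : 0 <= scale R k * discount R k ^+ 2.
  by apply: mulr_ge0; [exact: ltW|exact: sqr_ge0].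
have c01 : 0 <= (1 : R) <= 1 by rewrite lexx ler01.
have mX t : measurable_fun setT (X t).
  exact: (policy_measurable policyX model).
have maxP : is_maximizer (revenue (hard_demand k 1)) (optimal_price k (1 : R)).
  by apply: hard_maximizer => //; right.
apply: (@regret_ge _ _ _ _ _ _ _ (optimal_price k 1)) => //.
- by move=> t w; exact: policyX.1.
- by move=> t; exact: measurable_hard_revenue.
- by move=> x; exact: hard_revenue_ge0.
- by apply: mulr_ge0.
- apply: (measurable_stays policyX model).
  exact: measurable_gt.
apply: nearW => w.
have [/set_mem Sw|nSw] :=
  boolP (w \in stays X [set x | 1 - h < x] m); last first.
  rewrite indicE (negbTE nSw) mulr0.
  rewrite addr0; apply: sum_ord_le => t.
  by apply: maxP.2; exact: policyX.1.
rewrite indicE mem_set// mulr1 mulrC -[m%:R](sum_ord_lt _ (ltnW (ltn_ord m))).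
apply: sum_revenue_le => t.
have X01 := policyX.1 t w.
have [tm|tm] := boolP (t < m)%N; last by rewrite mulr0 addr0; exact: maxP.2.
rewrite mulr1 addrC -lerBrDr !revenue_hardE ?optimal_price01//.
have -> : optimal_price k 1 * (demand_poly k 1).[optimal_price k 1] =
    max_revenue1 R k by rewrite optimal_price1.
apply: (revenue_gap1_near k_gt0 X01 _ hk).
by have := Sw t tm; rewrite /=; lra.
Qed.

(** Off [stays], some price before round [m] is at most [1 - h]; monotonicity keeps it there in the
    remaining [n - m] rounds, each losing [scale (1 - x)^2 >= scale h^2]. *)
Lemma regret_descend (P : probability Omega R) (h : R) (m : 'I_n) :
  demand_model X D P (hard_demand k 0) -> markdown X P -> 0 < h ->
  (((n%:R - m%:R) * (scale R k * h ^+ 2) *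
    fine (P (~` stays X [set x | 1 - h < x] m)))%:E <=
   regret X P (hard_demand k 0))%E.
Proof.
move=> model md h0.
have s0 := scale_gt0 R k_gt0.
have g0 : 0 <= scale R k * h ^+ 2.
  by apply: mulr_ge0; [exact: ltW|exact: sqr_ge0].
have c01 : 0 <= (0 : R) <= 1 by rewrite lexx ler01.
have mX t : measurable_fun setT (X t).
  exact: (policy_measurable policyX model).
have maxP : is_maximizer (revenue (hard_demand k 0)) (optimal_price k (0 : R)).
  by apply: hard_maximizer => //; left.
apply: (@regret_ge _ _ _ _ _ _ _ (optimal_price k 0)) => //.
- by move=> t w; exact: policyX.1.
- by move=> t; exact: measurable_hard_revenue.
- by move=> x; exact: hard_revenue_ge0.
- by apply: mulr_ge0 => //; rewrite subr_ge0 ler_nat ltnW.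
- apply: measurableC; apply: (measurable_stays policyX model).
  exact: measurable_gt.
(* Finitely many almost sure comparisons hold simultaneously. *)
have : {ae P, forall w, forall s t : 'I_n, t = s.+1 :> nat -> X t w <= X s w}.
  apply: filter_forall => s; apply: filter_forall => t.
  have [ts|ts] := pselect (t = s.+1 :> nat); last by apply: nearW.
  by apply: filterS (md s t ts) => w Xts _.
apply: filterS => w mono.
have mono' (s t : 'I_n) : (s <= t)%N -> X t w <= X s w.
  case: t => t tn /=; elim: t tn => [|t IH] tn.
    rewrite leqn0 => /eqP st; rewrite (_ : s = Ordinal tn)//.
    exact: val_inj.
  rewrite leq_eqVlt => /predU1P[st|].
    by rewrite (_ : s = Ordinal tn)//; exact: val_inj.
  rewrite ltnS => st; apply: le_trans (IH (ltnW tn) st).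
  exact: mono.
have [/set_mem Sw|nSw] :=
  boolP (w \in ~` stays X [set x | 1 - h < x] m); last first.
  rewrite indicE (negbTE nSw) mulr0.
  rewrite addr0; apply: sum_ord_le => t.
  by apply: maxP.2; exact: policyX.1.
rewrite indicE mem_set// mulr1 mulrC -(sum_ord_ge _ (ltnW (ltn_ord m))).
apply: sum_revenue_le => t.
have X01 := policyX.1 t w.
have [tm|tm] := boolP (m <= t)%N; last by rewrite mulr0 addr0; exact: maxP.2.
rewrite mulr1 addrC -lerBrDr !revenue_hardE ?optimal_price01//.
have -> : optimal_price k 0 * (demand_poly k 0).[optimal_price k 0] = scale R k.
  rewrite optimal_price0; have := revenue_gap0 k (1 : R).
  by rewrite subrr expr0n mulr0 => /eqP; rewrite subr_eq0 => /eqP <-.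
rewrite revenue_gap0 ler_pM2l//.
have [s [sm Xs]] : exists s : 'I_n, (s < m)%N /\ X s w <= 1 - h.
  apply: contra_notP Sw => H s sm /=; rewrite ltNge; apply/negP => Xs.
  by apply: H; exists s.
have : X t w <= X s w by apply: mono'; exact: leq_trans (ltnW sm) tm.
by case/andP: X01 => *; rewrite lerXn2r ?nnegrE; lra.
Qed.

End LowerBound.

(** Take [m] as the integer part of [T = n h^2]. Since [T >= n h^(2k+2) = 1], rounding loses at most
    a factor 2; [h <= 1/2] gives [m <= T <= n/2]. *)
Lemma horizon_split (R : realType) (k n : nat) (h : R) :
  (0 < k)%N -> 0 < h <= 2^-1 -> n%:R * h ^+ (2 * k.+1) = 1 ->
  exists2 m : 'I_n, n%:R * h ^+ 2 <= 2 * m%:R &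
    m%:R * h ^+ (2 * k) <= 1 /\ n%:R <= 2 * (n%:R - m%:R) :> R.
Proof.
move=> k0 /andP[h0 h2] nh.
have h1 : h <= 1 by lra.
set T := n%:R * h ^+ 2.
have T1 : 1 <= T.
  rewrite -nh ler_wpM2l//; apply: (ler_wiXn2l (ltW h0) h1).
  by rewrite mulnS.
have T2 : 2 * T <= n%:R.
  rewrite /T mulrCA ler_piMr//.
  by rewrite expr2; nra.
have /andP[mT Tm] := truncn_itv (le_trans ler01 T1).
have mn : (Num.truncn T < n)%N.
  rewrite -(ltr_nat R); apply: le_lt_trans mT _; lra.
exists (Ordinal mn) => /=.
  have m1 : 1 <= (Num.truncn T)%:R :> R by rewrite ler1n truncn_gt0.
  by move: Tm; rewrite -natr1 => Tm; lra.
split; last by lra.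
have : T * h ^+ (2 * k) = 1 by rewrite -nh mulnS exprD mulrA.
by move=> E; rewrite -[leRHS]E; exact: (ler_wpM2r (exprn_ge0 _ (ltW h0)) mT).
Qed.


(** * Choice of constants and the case distinction *)

Section Main.
Variables (R : realType) (k : nat).
Hypothesis k_gt0 : (0 < k)%N.

Definition regret_const : R :=
  scale R k * discount R k ^+ 2 * expR (- ratio R k ^+ 2) / 16.

Lemma hard_family_regret : exists (c : R) (n0 : nat), 0 < c /\
    forall n : nat, (n0 <= n)%N ->
    forall (disp : measure_display) (Omega : measurableType disp)
           (X : 'I_n -> Omega -> R) (D : 'I_n -> Omega -> bool)
           (P : (R -> R) -> probability Omega R),
      is_policy X D ->
      (forall d, hard_family k d -> demand_model X D (P d) d) ->
      (forall d, hard_family k d -> markdown X (P d)) ->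
      ((c * n%:R `^ (k%:R / k.+1%:R))%:E <=
       family_regret X P (hard_family k))%E.
Proof.
have s0 := scale_gt0 R k_gt0; have u0 := discount_gt0 R k_gt0.
have e0 : 0 < expR (- ratio R k ^+ 2) by exact: expR_gt0.
have e1 : expR (- ratio R k ^+ 2) <= 1.
  by rewrite -expR0 ler_expR oppr_le0 sqr_ge0.
have u2 : 0 < discount R k ^+ 2 by rewrite exprn_gt0.
have u1 : discount R k ^+ 2 <= 1 by rewrite exprn_ile1 ?ltW ?discount_lt1.
have su : 0 < scale R k * discount R k ^+ 2 by exact: mulr_gt0.
have c0 : 0 < regret_const by apply: divr_gt0 => //; exact: mulr_gt0.
(* A window of width at most [b] satisfies the condition of [revenue_gap1_near]; also [b <= 1/2], as
   the choice of [m] requires. *)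
pose b : R := 2 * discount R k / (4 * k%:R + 2).
have kk : 0 < 4 * k%:R + 2 :> R by have := ler0n R k => ?; lra.
have b0 : 0 < b by apply: divr_gt0 => //; exact: mulr_gt0.
have b2 : b <= 2^-1.
  rewrite ler_pdivrMr//.
  have k1 : 1 <= k%:R :> R by rewrite ler1n.
  by have := discount_lt1 R k_gt0; lra.
exists regret_const, (Num.truncn (b^-1 ^+ (2 * k.+1))).+1; split => // n nn0.
move=> disp Omega X D P policyX model md.
have n0 : (0 < n)%N by exact: leq_trans nn0.
set h : R := window R k n.
have h0 : 0 < h by exact: window_gt0.
have hb : h <= b.
  apply: window_le => //; apply/ltW/(lt_le_trans (truncnS_gt _)).
  by rewrite ler_nat.
have [m Tm [mh nm]] : exists2 m : 'I_n, n%:R * h ^+ 2 <= 2 * m%:R &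
    m%:R * h ^+ (2 * k) <= 1 /\ n%:R <= 2 * (n%:R - m%:R) :> R.
  apply: (horizon_split k_gt0); last exact: window_pow.
  by rewrite h0 (le_trans hb).
rewrite -window_sqr// -/h; set T := n%:R * h ^+ 2 in Tm *.
have T0 : 0 <= T by rewrite /T mulr_ge0// sqr_ge0.
have F0 : hard_family k (hard_demand k (0 : R)) by left.
have F1 : hard_family k (hard_demand k (1 : R)) by right.
set top := [set x : R | 1 - h < x].
pose P0 := P (hard_demand k 0); pose P1 := P (hard_demand k 1).
have mtop : measurable top by exact: measurable_gt.
have mS : measurable (stays X top m).
  exact: (measurable_stays policyX (model _ F0)).
set E := expR _ in e0 e1.
have constE : regret_const = scale R k * discount R k ^+ 2 * E / 16 by [].
have hm : h * (4 * k%:R + 2) <= 2 * discount R k.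
  by rewrite -ler_pdivlMr.
(* If staying has probability at least 1/2 under [d0], it has probability at least [E / 4] under
   [d1], where it is costly; otherwise leaving is likely under [d0]. *)
have [big|small] := leP (2^-1) (fine (P0 (stays X top m))).
  have P1ge : E / 4 <= fine (P1 (stays X top m)).
    have K0 : 0 <= 1 + ratio R k ^+ 2 * h ^+ (2 * k).
      by rewrite addr_ge0// mulr_ge0 ?sqr_ge0// exprn_ge0// ltW.
    have := change_of_measure policyX (model _ F0) (model _ F1) m mtop
      (fun x x01 xh => chi2_top k_gt0 x01 xh) K0.
    rewrite -/P0 -/P1 => cm.
    (* From [1 + x <= exp x] and [m h^(2k) <= 1]: the divergence accumulated over [m] rounds stays
       bounded. *)
    have KE : (1 + ratio R k ^+ 2 * h ^+ (2 * k)) ^+ m <= E^-1.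
      apply: (@le_trans _ _ (expR (ratio R k ^+ 2 * h ^+ (2 * k)) ^+ m)).
        by rewrite lerXn2r ?nnegrE ?expR_ge0 ?expR_ge1Dx.
      rewrite -expRM_natl /E expRN invrK ler_expR mulrCA ler_piMr//.
      exact: sqr_ge0.
    have p0 : 0 <= fine (P1 (stays X top m)) by rewrite fine_ge0.
    have : 4^-1 <= E^-1 * fine (P1 (stays X top m)).
      apply: le_trans (ler_wpM2r p0 KE); apply: le_trans cm.
      move: big; set q := fine _ => big; nra.
    by rewrite mulrC ler_pdivlMr// mulrC.
  apply: (@le_trans _ _ (regret X P1 (hard_demand k 1))); last first.
    by apply: ereal_sup_ubound; exists (hard_demand k 1).
  apply: le_trans (regret_stay k_gt0 policyX m (model _ F1) hm).
  rewrite lee_fin -/P1 -/top constE.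
  move: su P1ge; set g := scale R k * _; set q := fine _ => su P1ge.
  apply: (@le_trans _ _ (g * E / 16 * (2 * m%:R))).
    by rewrite ler_wpM2l// divr_ge0// mulr_ge0// ltW.
  rewrite (_ : _ * (2 * m%:R) = m%:R * g * (E / 8)); last by field.
  by apply: ler_wpM2l; [rewrite mulr_ge0// ltW|lra].
apply: (@le_trans _ _ (regret X P0 (hard_demand k 0))); last first.
  by apply: ereal_sup_ubound; exists (hard_demand k 0).
apply: le_trans (regret_descend k_gt0 policyX m (model _ F0) (md _ F0) h0).
rewrite lee_fin -/P0 -/top probability_setC// fineB ?fin_num_measure//=.
move: small; set q := fine (P0 _) => small.
have sh : 0 <= scale R k * h ^+ 2 by rewrite mulr_ge0 ?sqr_ge0// ltW.
have rs : regret_const <= scale R k / 16.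
  rewrite constE; apply: ler_wpM2r => //; rewrite -mulrA.
  apply: ler_piMr; first exact: ltW.
  by apply: mulr_ile1 => //; exact: ltW.
apply: (@le_trans _ _ (scale R k / 16 * T)); first by rewrite ler_wpM2r.
(* Leaving has probability above 1/2, and at least [n/2] rounds remain. *)
apply: (@le_trans _ _ ((n%:R - m%:R) * (scale R k * h ^+ 2) * 2^-1)).
  rewrite /T (_ : _ / 16 * _ = n%:R * (scale R k * h ^+ 2) / 16); last by field.
  have : n%:R * (scale R k * h ^+ 2) <=
         2 * (n%:R - m%:R) * (scale R k * h ^+ 2).
    by rewrite ler_wpM2r.
  have : 0 <= n%:R * (scale R k * h ^+ 2) by rewrite mulr_ge0.
  by set z := scale R k * h ^+ 2; lra.
apply: ler_wpM2l; last by lra.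
by apply: mulr_ge0 => //; have := ler0n R n => ?; lra.
Qed.

End Main.

Unset Implicit Arguments.

Theorem theorem6 (R : realType) (k : nat) (hk : (1 <= k)%N) :
  exists F : set (R -> R),
    [/\ demand_family F, k_crossing k F &
    exists (c : R) (n0 : nat), 0 < c /\
    forall n : nat, (n0 <= n)%N ->
    forall (disp : measure_display) (Omega : measurableType disp)
           (X : 'I_n -> Omega -> R) (D : 'I_n -> Omega -> bool)
           (P : (R -> R) -> probability Omega R),
      is_policy X D ->
      (forall d, F d -> demand_model X D (P d) d) ->
      (forall d, F d -> markdown X (P d)) ->
      ((c * n%:R `^ (k%:R / k.+1%:R))%:E <= family_regret X P F)%E].
Proof.
exists (hard_family k); split; last exact: hard_family_regret.
  exact: hard_demand_family.
exact: hard_k_crossing.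
Qed.
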